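(* Let $\Gamma$ be a metric graph, $D$ a divisor on $\Gamma$, and $\Sigma\subseteq R(D)$ a tropical linear series of rank $r$ on $\Gamma$. If $\Gamma'\subseteq\Gamma$ is a metric subgraph, let $D'$ be the divisor on $\Gamma'$ given by \[ D'(w):=D(w)-\min_{\varphi\in\Sigma}\Big\{\sum_{\zeta}s_\zeta(\varphi)\Big\}\quad\text{for all } w\in\Gamma', \] where the sum is over all tangent vectors $\zeta$ from $w$ into the complement of $\Gamma'$. Then the restriction \[ \Sigma|_{\Gamma'}:=\{\varphi|_{\Gamma'} : \varphi\in\Sigma\}\subseteq R(D') \] is a tropical linear series of rank $r$ on $\Gamma'$.
   Context: Metric graphs and divisors. A metric graph $\Gamma$ is a compact, connected length metric space homeomorphic to a topological graph; a metric subgraph is a subset that is itself a metric graph (in particular closed and connected). A small neighborhood of $v\in\Gamma$ is a union of half-open segments glued at $v$; a tangent vector $\zeta$ based at $v$ is a direction at $v$ along one of these segments. A divisor is a finite formal sum $D=\sum_v D(v)\,v$ of points of $\Gamma$ with integer coefficients; its degree is $\sum_v D(v)$; it is effective ($D\ge 0$) if all $D(v)\geq 0$, and $D\ge E$ means $D-E\ge 0$. $\mathrm{PL}(\Gamma)$ is the set of continuous piecewise-linear functions $\varphi\colon\Gamma\to\mathbb{R}$ with integer slopes. $s_\zeta(\varphi)$ is the outgoing slope of $\varphi$ along $\zeta$, $\mathrm{ord}_v(\varphi)=-\sum_{\zeta} s_\zeta(\varphi)$ (sum over tangent vectors based at $v$), $\mathrm{div}(\varphi)=\sum_v \mathrm{ord}_v(\varphi)\,v$,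 and $R(D)=\{\varphi\in \mathrm{PL}(\Gamma) : \mathrm{div}(\varphi)+D\ge 0\}$. Tropical modules. A tropical linear combination of $\varphi_0,\dots,\varphi_k\in \mathrm{PL}(\Gamma)$ is $\min_i\{\varphi_i+a_i\}$ with $a_i\in\mathbb{R}$. A tropical submodule is a subset of $\mathrm{PL}(\Gamma)$ closed under all tropical linear combinations. A set $\{\varphi_0,\dots,\varphi_k\}$ is tropically dependent if there are real $a_i$ such that at every point of $\Gamma$ the minimum in $\min_i\{\varphi_i+a_i\}$ is achieved by at least two indices. Tropical linear series (recursive in $r\ge 0$). A tropical linear series of rank $r$ on $\Gamma$ is a tropical submodule $\Sigma\subseteq R(D)$ such that: (1) for every effective divisor $E$ of degree $r$ there is $\varphi\in\Sigma$ with $\mathrm{div}(\varphi)+D\ge E$; (2) every set of $r+2$ functions in $\Sigma$ is tropically dependent; (3) for each tangent vector $\zeta$ and each $0\le i<r$, the set $\{\varphi\in\Sigma : s_\zeta(\varphi)\le s_\zeta[i]\}$ contains a tropical linear series of rank $i$ (a submodule of $R(D)$). Here $s_\zeta[0]<\cdots<s_\zeta[r]$ are the distinct values of $s_\zeta(\varphi)$ for $\varphi\in\Sigma$, in increasing order; conditions (1) and (2) imply there are exactly $r+1$ of them. *)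

(* Defs.v *)
From HB Require Import structures.
From mathcomp Require Import all_boot all_order all_algebra.
From mathcomp Require Import all_classical all_reals all_analysis.

Set Implicit Arguments.
Unset Strict Implicit.
Unset Printing Implicit Defensive.

Import Order.TTheory GRing.Theory Num.Theory.
Import numFieldNormedType.Exports.

Local Open Scope classical_set_scope.
Local Open Scope ring_scope.

Section LengthMetric.
Context {R : realType} {T : metricType R}.

Definition chord_sum (c : R -> T) (a : R) (s : seq R) : R :=
  \sum_(i < size s) mdist (c (nth a (a :: s) i)) (c (nth a s i)).

(* [itv_partition 0 1 s] says that [0 :: s] is a strictly increasing
   subdivision of [0, 1] ending at 1. *)
Definition curve_length (c : R -> T) : \bar R :=
  ereal_sup [set (chord_sum c 0 s)%:E | s in [set s | itv_partition 0 1 s]].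

Definition curves (A : set T) (x y : T) : set (R -> T) :=
  [set c : R -> T | [/\ {within `[0, 1 : R], continuous c}, c 0 = x, c 1 = y &
              c @` `[0, 1] `<=` A]].

(* Induced length distance of a subset; it is +oo when no rectifiable curve
   inside A joins the two points. *)
Definition intrinsic_dist (A : set T) (x y : T) : \bar R :=
  ereal_inf [set curve_length c | c in curves A x y].

Definition length_space : Prop :=
  forall x y : T, (mdist x y)%:E = intrinsic_dist setT x y.

End LengthMetric.

Arguments length_space {R} T.

(* A finite graph structure on a (Hausdorff) space: a finite vertex set and
   finitely many edges with continuous characteristic maps, i.e. a finite CW
   structure of dimension at most 1. Loops, multiple edges and isolated
   vertices are allowed. *)
Definition topological_graph (R : realType) (T : topologicalType) : Prop :=
  exists (V : set T) (n : nat) (edge : 'I_n -> R -> T),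
    [/\ finite_set V,
        forall e, [/\ {within `[0, 1 : R], continuous (edge e)},
                      V (edge e 0) & V (edge e 1)],
        forall e (t : R), 0 < t < 1 -> ~ V (edge e t),
        forall e e' (t t' : R), 0 < t < 1 -> 0 < t' < 1 ->
          edge e t = edge e' t' -> e = e' /\ t = t'
      & forall x, V x \/ exists e, (edge e @` `[0, 1]) x].

Definition metric_graph (R : realType) (T : metricType R) : Prop :=
  [/\ [set: T] !=set0, compact [set: T], connected [set: T],
      length_space T & topological_graph R T].

(* A metric subgraph of T is given by a metric graph S together with a map
   identifying S with its image, endowed with the induced length metric
   (such a map is injective). The subset of T in question is [range iota]. *)
Definition metric_subgraph (R : realType) (S T : metricType R)
    (iota : S -> T) : Prop :=
  metric_graph S /\
  forall x y : S, (mdist x y)%:E = intrinsic_dist (range iota) (iota x) (iota y).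

Section Functions.
Context {R : realType} {T : metricType R}.
Implicit Types (v x : T) (phi : T -> R) (D E : T -> int) (Sigma : set (T -> R)).

Definition isometric_on (I : set R) (c : R -> T) : Prop :=
  forall s t, I s -> I t -> mdist (c s) (c t) = `|s - t|.

Definition piecewise_linear phi : Prop :=
  continuous phi /\
  exists (n : nat) (seg : 'I_n -> R -> T) (len : 'I_n -> R) (m : 'I_n -> int),
    [/\ forall i, isometric_on `[0, len i] (seg i),
        forall x, exists i, (seg i @` `[0, len i]) x
      & forall i (t : R), 0 <= t <= len i ->
          phi (seg i t) = phi (seg i 0) + (m i)%:~R * t].

(* Arc-length parametrized half-open segments [0, eps[ starting at v. The
   values of the curve outside [0, eps[ are irrelevant. *)
Definition rays v : set (R -> T) :=
  [set c | c 0 = v /\ exists2 eps : R, 0 < eps & isometric_on `[0, eps[ c].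

Definition germ (c : R -> T) : set (R -> T) :=
  [set c' | c' 0 = c 0 /\ \forall t \near 0^'+, c' t = c t].

(* A tangent vector at v is the germ at v of a half-open segment. *)
Definition tangent_vectors v : set (set (R -> T)) :=
  [set germ c | c in rays v].

(* The integer m such that phi has slope m near the origin of zeta; it exists
   and is unique when phi is piecewise linear and zeta is a tangent vector. *)
Definition slope (zeta : set (R -> T)) phi : int :=
  xget 0 [set m : int | exists2 c, zeta c &
    \forall t \near 0^'+, phi (c t) = phi (c 0) + m%:~R * t].

Definition ord phi v : int :=
  - \sum_(zeta \in tangent_vectors v) slope zeta phi.

Definition is_divisor D : Prop := finite_set [set v | D v != 0].

Definition degree D : int := \sum_(v \in [set: T]) D v.

Definition RR D : set (T -> R) :=
  [set phi | piecewise_linear phi /\ forall v, 0 <= ord phi v + D v].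

Definition tropical_comb k (phi : 'I_k.+1 -> T -> R) (a : 'I_k.+1 -> R) : T -> R :=
  fun x => \big[Order.min/phi ord0 x + a ord0]_(i < k.+1) (phi i x + a i).

Definition tropical_submodule Sigma : Prop :=
  Sigma `<=` piecewise_linear /\
  forall k (phi : 'I_k.+1 -> T -> R) (a : 'I_k.+1 -> R),
    (forall i, Sigma (phi i)) -> Sigma (tropical_comb phi a).

Definition tropically_dependent k (phi : 'I_k -> T -> R) : Prop :=
  exists a : 'I_k -> R, forall x, exists i j : 'I_k,
    [/\ i != j,
        forall l, phi i x + a i <= phi l x + a l
      & forall l, phi j x + a j <= phi l x + a l].

Definition slopes Sigma (zeta : set (R -> T)) : set int :=
  [set slope zeta phi | phi in Sigma].

(* m = s_zeta[i]: it is attained, and exactly i attained values are smaller. *)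
Definition nth_slope Sigma (zeta : set (R -> T)) (i : nat) (m : int) : Prop :=
  slopes Sigma zeta m /\ ([set m' | slopes Sigma zeta m' /\ m' < m] #= `I_i)%card.

(* The recursion on the rank is expressed by an inductive predicate: the
   recursive occurrence is at a rank i < r. *)
Inductive tropical_linear_series D : nat -> set (T -> R) -> Prop :=
| TropicalLinearSeries (r : nat) Sigma :
    tropical_submodule Sigma ->
    Sigma `<=` RR D ->
    (forall E, is_divisor E -> (forall v, 0 <= E v) -> degree E = r%:Z ->
       exists2 phi, Sigma phi & forall v, E v <= ord phi v + D v) ->
    (forall phi : 'I_r.+2 -> T -> R, injective phi ->
       (forall i, Sigma (phi i)) -> tropically_dependent phi) ->
    (forall v zeta i m, tangent_vectors v zeta -> (i < r)%N ->
       nth_slope Sigma zeta i m ->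
       exists2 Sigma', Sigma' `<=` [set phi | Sigma phi /\ slope zeta phi <= m] &
         tropical_linear_series D i Sigma') ->
    tropical_linear_series D r Sigma.

(* Tangent vectors at v pointing into the complement of A. *)
Definition outward_tangent_vectors (A : set T) v : set (set (R -> T)) :=
  [set zeta | tangent_vectors v zeta /\
     exists2 c, zeta c & \forall t \near 0^'+, ~ A (c t)].

End Functions.

(* The least element of a set of integers, 0 if there is none. *)
Definition int_min (A : set int) : int :=
  xget 0 [set m | A m /\ forall m', A m' -> m <= m'].

Definition restricted_divisor (R : realType) (S T : metricType R)
    (iota : S -> T) (D : T -> int) (Sigma : set (T -> R)) : S -> int :=
  fun w => D (iota w) - int_min
    [set \sum_(zeta \in outward_tangent_vectors (range iota) (iota w))
            slope zeta phi | phi in Sigma].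

Definition restricted_series (R : realType) (S T : metricType R)
    (iota : S -> T) (Sigma : set (T -> R)) : set (S -> R) :=
  [set phi \o iota | phi in Sigma].

(* Main.v *)
Require Import Defs.
From mathcomp Require Import all_boot all_order all_algebra.
From mathcomp Require Import all_classical all_reals all_analysis.
From mathcomp Require Import lra zify.

(* The frontier of a closed connected subset A of a finite graph is finite: three
   frontier points on one open edge would produce a point of A enclosed on that edge
   between two points outside A, so A would be contained in the enclosed arc.
   Cutting the isometric segments carrying a piecewise linear function at the
   frontier gives arcs contained in A, and an arc that is isometric in the ambient
   graph and contained in A stays isometric for the induced length metric.  Two rays
   at a point of a graph that meet at arbitrarily small parameters have the same germ,
   so every ray follows one of finitely many isometric segments; hence the tangent
   vectors at a point w of the subgraph are exactly the tangent vectors of the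
   ambient graph at w that do not point out of A.  This gives
   ord_w(phi|A) = ord_w(phi) + (sum of the outward slopes of phi), and tropical
   dependence leaves finitely many slopes along each tangent vector, so that the
   minimum defining the restricted divisor exists.  The conditions on a tropical
   linear series then restrict directly, by induction on the rank. *)

Set Implicit Arguments.
Unset Strict Implicit.
Unset Printing Implicit Defensive.

Import Order.TTheory GRing.Theory Num.Theory.
Import numFieldNormedType.Exports.

Local Open Scope classical_set_scope.
Local Open Scope ring_scope.

(** * Connected subsets and one-sided limits *)

Section Connectedness.
Context {T : topologicalType}.
Implicit Types A C U W : set T.

Lemma connected_open_cover C U W : connected C -> open U -> open W ->
  C `<=` U `|` W -> C `&` (U `&` W) = set0 -> (C `&` U) !=set0 -> C `<=` U.
Proof.
move=> Cc oU oW CUW CUW0 CU0; suff -> : C = C `&` U by move=> x [].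
apply/esym/Cc => //; first by exists U.
exists (~` W); first exact: open_closedC.
apply/seteqP; split=> x [Cx Ux]; split=> //.
  by move=> Wx; rewrite -[False]/(set0 x) -CUW0.
by case: (CUW _ Cx).
Qed.

Lemma connected_avoid_boundary C A : connected C -> closed A ->
  C `&` (A `\` A°) = set0 -> C `<=` A \/ C `<=` ~` A.
Proof.
move=> Cc clA CA0.
have [CA|CA] := pselect ((C `&` A°) !=set0); last first.
  right=> x Cx Ax; apply: CA; exists x; split=> //; apply: contrapT => Aox.
  by rewrite -[False]/(set0 x) -CA0.
left; apply: subset_trans (@interior_subset _ A).
apply: (@connected_open_cover _ _ (~` A)) => //.
- exact: open_interior.
- exact: closed_openC.
- move=> x Cx; have [Ax|Ax] := pselect (A x); last by right.
  left; apply: contrapT => Aox.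
  by rewrite -[False]/(set0 x) -CA0.
- by apply/seteqP; split=> x // [_ [/interior_subset ? ?]].
Qed.

End Connectedness.

Lemma near_at_right0P {R : realType} (P : R -> Prop) :
  (\forall t \near 0^'+, P t) <-> exists2 d, 0 < d & forall t, 0 < t < d -> P t.
Proof.
split=> [|[d d0 H]].
  move=> /nbhs_ballP[d /= d0 H]; exists d => // t /andP[t0 td].
  by apply: H => //; rewrite /ball /= sub0r normrN gtr0_norm.
near=> t; apply: H; apply/andP; split; near: t; first exact: nbhs_right_gt.
exact: nbhs_right_lt.
Unshelve. all: by end_near. Qed.

(** The doubly negated form on the left is used throughout to express that [P] holds at arbitrarily
    small positive parameters. *)
Lemma frequently_at_right0P {R : realType} (P : R -> Prop) :
  (~ \forall t \near 0^'+, ~ P t) <->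
  forall d, 0 < d -> exists2 t, 0 < t < d & P t.
Proof.
split=> [H d d0|H /near_at_right0P[d /H[t td Pt] /(_ t td)]//].
apply: contrapT => K; apply: H; apply/near_at_right0P; exists d => // t td Pt.
by apply: K; exists t.
Qed.

Lemma frequently_or {R : realType} (P Q : R -> Prop) :
  (~ \forall t \near 0^'+, ~ (P t \/ Q t)) ->
  (~ \forall t \near 0^'+, ~ P t) \/ (~ \forall t \near 0^'+, ~ Q t).
Proof.
move=> H; apply: contrapT => /not_orP[/contrapT HP /contrapT HQ]; apply: H.
by apply: filterS2 HP HQ => t ? ? [].
Qed.

(** * Isometric curves *)

Section Isometries.
Context {R : realType} {T : metricType R}.
Implicit Types (c : R -> T) (I J : set R).

Lemma sub_isometric_on I J c : I `<=` J -> isometric_on J c -> isometric_on I c.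
Proof. by move=> IJ Jc s t /IJ ? /IJ ?; exact: Jc. Qed.

Lemma isometric_inj I c s t : isometric_on I c -> I s -> I t -> c s = c t -> s = t.
Proof.
move=> Ic Is It cst; have := Ic _ _ Is It; rewrite cst mdistxx.
by move/esym/eqP; rewrite normr_eq0 subr_eq0 => /eqP.
Qed.

Lemma lipschitz_within_continuous I c (K : R) :
  (forall s t, I s -> I t -> mdist (c s) (c t) <= K * `|s - t|) ->
  {within I, continuous c}.
Proof.
move=> Kc; apply/subspace_continuousP => x Ix.
apply/metricType_numDomainType.cvgrPdist_lt => e e0; rewrite near_withinE.
(* [K] may be zero or negative, so the radius is divided by the positive constant [|K| + 1]. *)
have K0 : 0 < `|K| + 1 by rewrite ltr_wpDl.
have /nbhs_ballP[d d0 xd] : nbhs x (ball x (e / (`|K| + 1))).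
  by apply: nbhsx_ballx; rewrite divr_gt0.
apply/nbhs_ballP; exists d => // y /xd; rewrite /ball /= ltr_pdivlMr // => xy Iy.
apply: le_lt_trans xy; apply: le_trans (Kc _ _ Ix Iy) _.
rewrite mulrC ler_wpM2l // (le_trans (ler_norm K)) // lerDl; exact: ler01.
Qed.

Lemma isometric_continuous I c : isometric_on I c -> {within I, continuous c}.
Proof.
move=> Ic; apply: (@lipschitz_within_continuous _ _ 1) => s t Is It.
by rewrite Ic // mul1r.
Qed.

Lemma isometric_for_continuous a b c t : isometric_on `]a, b[ c -> a < t < b ->
  {for t, continuous c}.
Proof.
move=> Ic atb; have oI : open [set` `]a, b[] by exact: interval_open.
have := isometric_continuous Ic; rewrite continuous_open_subspace //; apply.
by rewrite inE /= in_itv.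
Qed.

End Isometries.

(** * Finite topological graphs *)

Section TopologicalGraph.
Context {R : realType} {T : topologicalType}.
Hypothesis hausdorffT : hausdorff_space T.
Context (V : set T) (n : nat) (edge : 'I_n -> R -> T).
Hypothesis finV : finite_set V.
Hypothesis edge_continuous : forall e, {within `[0, 1 : R], continuous (edge e)}.
Hypothesis edge_ends : forall e, V (edge e 0) /\ V (edge e 1).
Hypothesis edge_notV : forall e (t : R), 0 < t < 1 -> ~ V (edge e t).
Hypothesis edge_inj : forall e e' (t t' : R), 0 < t < 1 -> 0 < t' < 1 ->
  edge e t = edge e' t' -> e = e' /\ t = t'.
Hypothesis edge_cover : forall x, V x \/ exists e, (edge e @` `[0, 1]) x.

Lemma closed_edge_image e (a b : R) : 0 <= a -> b <= 1 -> closed (edge e @` `[a, b]).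
Proof.
move=> a0 b1; apply: compact_closed => //; apply: continuous_compact.
  apply: continuous_subspaceW (@edge_continuous e) => x /=.
  rewrite !in_itv /= => /andP[ax xb].
  by rewrite (le_trans a0 ax) (le_trans xb b1).
exact: segment_compact.
Qed.

(** The complement is a finite union of closed sets: the vertices, the other closed edges, and the
    two closed ends of [e]. *)
Lemma open_edge_image e (a b : R) : 0 <= a <= 1 -> 0 <= b <= 1 ->
  open (edge e @` `]a, b[).
Proof.
move=> /andP[a0 a1] /andP[b0 b1].
rewrite -[X in open X]setCK; apply: closed_openC.
suff -> : ~` (edge e @` `]a, b[) =
    V `|` \bigcup_(e' in [set e' | e' != e]) (edge e' @` `[0, 1])
      `|` (edge e @` `[0, a] `|` edge e @` `[b, 1]).
  apply: closedU; first apply: closedU.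
  - by have /accessible_finite_set_closed := hausdorff_accessible hausdorffT; apply.
  - by apply: closed_bigcup => [|e' _]; [exact: finite_finset|exact: closed_edge_image].
  - by apply: closedU; exact: closed_edge_image.
apply/seteqP; split=> [x xNab|x Hx [u]] /=.
  have [Vx|[e' [t /= t01 etx]]] := edge_cover x; first by left; left.
  have [e'e|e'e] := eqVneq e' e; last by left; right; exists e' => //; exists t.
  right; subst e'; move: t01; rewrite in_itv /= => /andP[t0 t1].
  have [ta|at_] := leP t a; first by left; exists t => //=; rewrite in_itv /= t0.
  have [bt|tb] := leP b t; first by right; exists t => //=; rewrite in_itv /= bt.
  by case: xNab; exists t => //=; rewrite in_itv /= at_.
rewrite in_itv /= => /andP[au ub] eux.
have u01 : 0 < u < 1 by rewrite (le_lt_trans a0 au) (lt_le_trans ub b1).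
(* Endpoints of edges are vertices and [x] is not one, so any preimage of [x] is interior to its
   edge and injectivity applies. *)
have key e' t : 0 <= t <= 1 -> edge e' t = x -> e' = e /\ t = u.
  move=> /andP[t0 t1] e'tx.
  have [t00|t00] := eqVneq t 0.
    by case: (@edge_notV e u u01); rewrite eux -e'tx t00; case: (edge_ends e').
  have [t11|t11] := eqVneq t 1.
    by case: (@edge_notV e u u01); rewrite eux -e'tx t11; case: (edge_ends e').
  apply: edge_inj => //; last by rewrite e'tx.
  by rewrite lt_neqAle eq_sym t00 t0 lt_neqAle t11 t1.
case: Hx => [[Vx|[e' /= /eqP e'e [t]]]|[[t]|[t]]]; rewrite /= ?in_itv /=.
- by apply: (@edge_notV e u u01); rewrite eux.
- by move=> t01 /(key _ _ t01)[].
- move=> /andP[t0 ta] /key; rewrite t0 (le_trans ta a1) => /(_ isT)[_ tu].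
  by move: ta; rewrite tu leNgt au.
- move=> /andP[bt t1] /key; rewrite t1 (le_trans b0 bt) => /(_ isT)[_ tu].
  by move: bt; rewrite tu leNgt ub.
Qed.

(* The inverse of [edge e] on the open edge, and junk elsewhere. *)
Definition edge_coordinate e (x : T) : R := xget 0 [set u | 0 < u < 1 /\ edge e u = x].

Lemma edgeK e u : 0 < u < 1 -> edge_coordinate e (edge e u) = u.
Proof.
move=> u01; rewrite /edge_coordinate; apply: xget_unique => // w [w01].
by move=> /edge_inj[].
Qed.

(** The interval of radius [d] around [u], clipped to the unit interval, has an open image, on which
    the coordinate stays within [d] of [u]. *)
Lemma edge_coordinate_continuous e u : 0 < u < 1 ->
  {for edge e u, continuous (edge_coordinate e)}.
Proof.
move=> u01; apply/cvgrPdist_lt => d d0; rewrite edgeK //.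
pose a := Num.max 0 (u - d); pose b := Num.min 1 (u + d).
have aub : a < u < b by rewrite /a /b gt_max lt_min; move: u01 d0; lra.
have a01 : 0 <= a <= 1.
  by rewrite /a le_max lexx ge_max ler01 /=; move: u01 d0; lra.
have b01 : 0 <= b <= 1.
  by rewrite /b ge_min lexx le_min ler01 /= andbT; move: u01 d0; lra.
have NU : nbhs (edge e u) (edge e @` `]a, b[).
  apply: open_nbhs_nbhs; split; first exact: open_edge_image.
  by exists u => //=; rewrite in_itv.
apply: filterS NU => y [w /=]; rewrite in_itv /= => /andP[aw wb] <-.
move: aw wb; rewrite /a /b gt_max lt_min => /andP[w0 dw] /andP[w1 wd].
rewrite edgeK ?w0 //; rewrite ltr_distl; move: dw wd; lra.
Qed.

(** Both ends of the arc miss [A], so [A] is covered by the open arc and the complement of the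
    closed arc; it meets the former at [x2]. *)
Lemma connected_edge_interval (A : set T) e (x1 x2 x3 : R) : connected A ->
  0 < x1 -> x1 < x2 -> x2 < x3 -> x3 < 1 ->
  ~ A (edge e x1) -> A (edge e x2) -> ~ A (edge e x3) ->
  A `<=` edge e @` `]x1, x3[.
Proof.
move=> cA x10 x12 x23 x31 A1 A2 A3.
have x1I : 0 <= x1 <= 1 by lra.
have x3I : 0 <= x3 <= 1 by lra.
apply: (@connected_open_cover _ _ _ (~` (edge e @` `[x1, x3]))) => //.
- exact: open_edge_image.
- by apply: closed_openC; apply: closed_edge_image; lra.
- move=> x Ax; have [[u /= + eux]|] := pselect ((edge e @` `[x1, x3]) x); last by right.
  rewrite in_itv /= => /andP[x1u ux3]; left; exists u => //=; rewrite in_itv /=.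
  rewrite !lt_neqAle x1u ux3 !andbT; apply/andP; split; apply/eqP => ux.
    by apply: A1; rewrite ux eux.
  by apply: A3; rewrite -ux eux.
- apply/seteqP; split=> x // [_ [[u /= uI eux]]]; apply; exists u => //.
  by move: uI; rewrite /= !in_itv /= => /andP[/ltW -> /ltW ->].
- by exists (edge e x2); split=> //; exists x2 => //=; rewrite in_itv /= x12.
Qed.

Lemma edge_boundary_le2 (A : set T) e (u1 u2 u3 : R) : connected A -> closed A ->
  0 < u1 -> u1 < u2 -> u2 < u3 -> u3 < 1 ->
  (A `\` A°) (edge e u1) -> (A `\` A°) (edge e u2) -> (A `\` A°) (edge e u3) ->
  False.
Proof.
move=> cA clA u10 u12 u23 u31 [A1 o1] [A2 o2] [A3 o3].
have near_out u a b : 0 < u < 1 -> 0 <= a -> a < u -> u < b -> b <= 1 -> ~ A° (edge e u) ->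
    exists2 w, a < w < b & ~ A (edge e w).
  move=> u01 a0 au ub b1 ou; apply: contrapT => H; apply: ou.
  have oI : open (edge e @` `]a, b[) by apply: open_edge_image; lra.
  have NU : nbhs (edge e u) (edge e @` `]a, b[).
    by apply: open_nbhs_nbhs; split=> //; exists u => //=; rewrite in_itv /= au.
  apply: filterS NU => y [w /=]; rewrite in_itv /= => wI <-.
  by apply: contrapT => Aw; apply: H; exists w.
(* This [x] outside [A] lies on one side of [u2]. A second point outside [A], found near the
   frontier point on the other side, traps [A] in an arc around [u2] that excludes the frontier
   point beyond [x]. *)
have [x] := near_out u2 u1 u3 ltac:(lra) ltac:(lra) u12 u23 ltac:(lra) o2.
move=> /andP[u1x xu3] Ax.
have {}xu2 : x != u2 by apply/eqP => xu2; apply: Ax; rewrite xu2.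
have [xu2'|u2x] := ltP x u2.
- have [z /andP[u2z z1] Az] := near_out u3 u2 1 ltac:(lra) ltac:(lra) u23 ltac:(lra) ltac:(lra) o3.
  have := @connected_edge_interval A e x u2 z cA ltac:(lra) xu2' u2z z1 Ax A2 Az _ A1.
  move=> [w /=]; rewrite in_itv /= => /andP[xw wz] /edge_inj[].
  + lra.
  + lra.
  + by move=> _; lra.
- have {}u2x : u2 < x by rewrite lt_neqAle eq_sym xu2.
  have [y /andP[y0 yu2] Ay] := near_out u1 0 u2 ltac:(lra) ltac:(lra) ltac:(lra) u12 ltac:(lra) o1.
  have := @connected_edge_interval A e y u2 x cA y0 yu2 u2x ltac:(lra) Ay A2 Ax _ A3.
  move=> [w /=]; rewrite in_itv /= => /andP[yw wx] /edge_inj[].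
  + lra.
  + lra.
  + by move=> _; lra.
Qed.

Lemma finite_boundary (A : set T) : connected A -> closed A -> finite_set (A `\` A°).
Proof.
move=> cA clA.
pose B e := [set u : R | 0 < u < 1 /\ (A `\` A°) (edge e u)].
suff finB e : finite_set (B e).
  apply: (@sub_finite_set _ _ (V `|` \bigcup_(e in setT) (edge e @` B e))).
    move=> x ABx; have [|[e [u /= u01 eux]]] := edge_cover x; first by left.
    move: u01; rewrite in_itv /= => /andP[u0 u1].
    have [u00|u00] := eqVneq u 0.
      by left; rewrite -eux u00; case: (edge_ends e).
    have [u11|u11] := eqVneq u 1.
      by left; rewrite -eux u11; case: (edge_ends e).
    right; exists e => //; exists u => //; split; last by rewrite eux.
    by rewrite lt_neqAle eq_sym u00 u0 lt_neqAle u11 u1.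
  rewrite finite_setU; split=> //; apply: bigcup_finite; first exact: finite_finset.
  by move=> e _; exact: finite_image.
apply: contrapT => /(infinite_set_fset 3)[F FB F3].
have [s [ss sz sF]] : exists s : seq R,
    [/\ sorted <%R s, size s = size (finmap.enum_fset F) & {subset s <= finmap.enum_fset F}].
  exists (sort <=%R (finmap.enum_fset F)).
  split; [|by rewrite size_sort|by move=> x; rewrite mem_sort].
  by rewrite lt_sorted_uniq_le sort_uniq finmap.fset_uniq sort_sorted //; exact: le_total.
move: F3 ss sF; rewrite -sz; case: s sz => [//|u1 [//|u2 [//|u3 s]]] _ _ /=.
move=> /and3P[u12 u23 _] sF.
have Bu u : u \in [:: u1, u2, u3 & s] -> B e u by move=> /sF uF; exact: FB.
have [u1I b1] := Bu u1 ltac:(by rewrite !inE eqxx).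
have [u2I b2] := Bu u2 ltac:(by rewrite !inE eqxx orbT).
have [u3I b3] := Bu u3 ltac:(by rewrite !inE eqxx !orbT).
apply: (@edge_boundary_le2 A e u1 u2 u3) => //; lra.
Qed.

End TopologicalGraph.

(** * Rays *)

Lemma near_right_avoid_finite {R : realType} (S : set R) : finite_set S ->
  \forall t \near 0^'+, ~ S t.
Proof.
move=> finS.
have clS : closed (S `\ 0).
  have /accessible_finite_set_closed := hausdorff_accessible (@Rhausdorff R).
  by apply; exact: finite_setD.
have oS : nbhs 0 (~` (S `\ 0)).
  by apply: open_nbhs_nbhs; split; [exact: closed_openC|move=> [_]; apply].
rewrite /at_right near_withinE; apply: filterS oS => t St t0 Stt; apply: St.
by split=> // t00; move: t0; rewrite t00 ltxx.
Qed.

Section Rays.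
Context {R : realType} {T : metricType R}.
Implicit Types (c : R -> T) (v : T).

Lemma isometric_dist0 c (I : set R) (t : R) : isometric_on I c ->
  I 0 -> I t -> 0 <= t -> mdist (c 0) (c t) = t.
Proof. by move=> Ic I0 It t0; rewrite Ic // sub0r normrN ger0_norm. Qed.

Lemma ray_dist c v : rays v c -> \forall t \near 0^'+, mdist v (c t) = t.
Proof.
move=> [<- [eps eps0 Ic]]; apply/near_at_right0P; exists eps => // t /andP[t0 te].
by rewrite (isometric_dist0 Ic) //= ?in_itv /= ?lexx ?ltW.
Qed.

(** A small parameter of a ray is the distance to its origin, so [F] can be hit only at the finitely
    many distances from [v] to [F]. *)
Lemma ray_avoid_finite c v (F : set T) : rays v c -> finite_set F ->
  \forall t \near 0^'+, ~ F (c t).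
Proof.
move=> /ray_dist cv finF.
have := near_right_avoid_finite (finite_image (mdist v) finF).
by apply: filterS2 cv => t ct H Fct; apply: H; exists (c t).
Qed.

Lemma ray_connected c (eps d : R) : isometric_on `[0, eps[ c -> d <= eps ->
  connected (c @` `]0, d[).
Proof.
move=> Ic de; apply: connected_continuous_connected.
  by apply/connected_intervalP; exact: interval_is_interval.
apply: isometric_continuous; apply: sub_isometric_on Ic => t /=.
by rewrite !in_itv /= => /andP[/ltW -> /lt_le_trans->].
Qed.

(** Off the vertices each ray stays in one open edge, the same for both since they meet. The
    coordinate on that edge reduces the claim to the intermediate value theorem on an interval. *)
Lemma rays_near_eq c c' v : topological_graph R T -> rays v c -> rays v c' ->
  (~ \forall t \near 0^'+, ~ (c t = c' t)) -> \forall t \near 0^'+, c t = c' t.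
Proof.
move=> [V [n [edge [finV Hedge edge_notV edge_inj edge_cover]]]] rc rc'.
have hT := @metric_hausdorff R T.
have edge_cont e : {within `[0, 1 : R], continuous (edge e)} by case: (Hedge e).
have edge_ends e : V (edge e 0) /\ V (edge e 1) by case: (Hedge e).
have oE e (a b : R) : 0 <= a <= 1 -> 0 <= b <= 1 -> open (edge e @` `]a, b[).
  exact: (open_edge_image hT finV).
move=> /frequently_at_right0P freq.
have [[c0 [eps eps0 Ic]] [c'0 [eps' eps'0 Ic']]] := (rc, rc').
have /near_at_right0P[d0 d00 cV] := ray_avoid_finite rc finV.
have /near_at_right0P[d1 d10 c'V] := ray_avoid_finite rc' finV.
pose d := Num.min (Num.min d0 d1) (Num.min eps eps').
have d_gt0 : 0 < d by rewrite !lt_min d00 d10 eps0 eps'0.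
have [dd0 dd1 de de'] : [/\ d <= d0, d <= d1, d <= eps & d <= eps'].
  by rewrite !ge_min !lexx ?orbT.
have interior x : ~ V x -> exists e, exists2 u, 0 < u < 1 & edge e u = x.
  move=> Vx; have [//|[e [u /=]]] := edge_cover x.
  rewrite in_itv /= => /andP[u0 u1] eux; exists e, u => //.
  have [u00|u00] := eqVneq u 0.
    by exfalso; apply: Vx; rewrite -eux u00; case: (edge_ends e).
  have [u11|u11] := eqVneq u 1.
    by exfalso; apply: Vx; rewrite -eux u11; case: (edge_ends e).
  by rewrite lt_neqAle eq_sym u00 u0 lt_neqAle u11 u1.
have [t0 /andP[t00 t0d] ct0] := freq d d_gt0.
have [e [u0 u0I eu0]] : exists e, exists2 u, 0 < u < 1 & edge e u = c t0.
  by apply: interior; apply: cV; rewrite t00 (lt_le_trans t0d).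
(* The open edges are disjoint and open, so a connected curve without vertices that touches [e] at
   [t0] never leaves it. *)
have stay (k : R -> T) ek dk : isometric_on `[0, ek[ k -> d <= ek -> d <= dk ->
    (forall t, 0 < t < dk -> ~ V (k t)) -> k t0 = c t0 ->
    forall t, 0 < t < d -> exists2 u, 0 < u < 1 & edge e u = k t.
  move=> Ik dek ddk kV kt0 t tI.
  suff /(_ (k t)) : k @` `]0, d[ `<=` edge e @` `]0, 1[.
    case; first by exists t => //=; rewrite in_itv.
    by move=> u /= + eu; rewrite in_itv /= => uI; exists u.
  apply: (@connected_open_cover _ _ _
     (\bigcup_(e' in [set e' | e' != e]) (edge e' @` `]0, 1[))).
  - exact: ray_connected Ik dek.
  - by apply: oE; rewrite lexx ler01.
  - by apply: bigcup_open => e' _; apply: oE; rewrite lexx ler01.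
  - move=> _ [s /= + <-]; rewrite in_itv /= => /andP[s0 sd].
    have [|e' [u uI eu]] := interior (k s).
      by apply: kV; rewrite s0 (lt_le_trans sd).
    have [<-|e'e] := eqVneq e' e; first by left; exists u => //=; rewrite in_itv.
    by right; exists e' => //; exists u => //=; rewrite in_itv.
  - apply/seteqP; split=> x // [_ [[u /= uI eu] [e' /= e'e [u' /= u'I eu']]]].
    move: uI u'I; rewrite !in_itv /= => uI u'I.
    have [ee _] := edge_inj e' e u' u u'I uI (etrans eu' (esym eu)).
    by move: e'e; rewrite ee eqxx.
  - exists (k t0); split; first by exists t0 => //=; rewrite in_itv /= t00.
    by exists u0 => //=; rewrite ?in_itv //= kt0.
have cE := stay c eps d0 Ic de dd0 cV erefl.
have c'E := stay c' eps' d1 Ic' de' dd1 c'V (esym ct0).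
pose g := edge_coordinate edge e.
have gE u : 0 < u < 1 -> g (edge e u) = u by exact: edgeK.
have gcont (k : R -> T) ek : isometric_on `[0, ek[ k -> d <= ek ->
    (forall t, 0 < t < d -> exists2 u, 0 < u < 1 & edge e u = k t) ->
    {within `]0, d[, continuous (g \o k)}.
  move=> Ik dek kE; apply: continuous_in_subspaceT => t.
  rewrite inE /= in_itv /= => tI; apply: continuous_comp.
    apply: (@isometric_for_continuous _ _ 0 d) => //.
    apply: sub_isometric_on Ik => s /=.
    by rewrite !in_itv /= => /andP[/ltW -> /lt_le_trans->].
  have [u uI <-] := kE t tI.
  exact: (edge_coordinate_continuous hT finV).
have gc := gcont c eps Ic de cE.
have gc' := gcont c' eps' Ic' de' c'E.
have gc_inj : {in `]0, d[ &, injective (g \o c)}.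
  move=> s t; rewrite !in_itv /= => sI tI.
  have [[u uI eu] [w wI ew]] := (cE s sI, cE t tI).
  rewrite -eu -ew !gE // => uw; apply: (isometric_inj Ic) => /=.
  - by move: sI; rewrite in_itv /= => /andP[/ltW -> /lt_le_trans->].
  - by move: tI; rewrite in_itv /= => /andP[/ltW -> /lt_le_trans->].
  - by rewrite -eu -ew uw.
have mono := itv_continuous_inj_mono gc gc_inj.
apply/near_at_right0P; exists t0 => // t /andP[t_gt0 tt0].
have [t1 /andP[t1_gt0 t1t] ct1] := freq t t_gt0.
have I0 : t0 \in `]0, d[ by rewrite in_itv /= t00.
have It : t \in `]0, d[ by rewrite in_itv /= t_gt0 (lt_trans tt0).
have I1 : t1 \in `]0, d[ by rewrite in_itv /= t1_gt0 (lt_trans t1t (lt_trans tt0 t0d)).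
(* The curves meet at [t1 < t < t0]. By monotonicity of [g \o c], the value at [t] lies between
   those at the two meeting points, so [c'] takes it as well. *)
have [|||s sI gcs] := @IVT R (g \o c') t1 t0 (g (c t)).
- exact: ltW (lt_trans t1t tt0).
- apply: continuous_subspaceW gc' => s /=; rewrite !in_itv /=.
  by move=> /andP[/(lt_le_trans t1_gt0)-> /le_lt_trans->].
- rewrite /= -ct1 -ct0 ge_min le_max.
  case: mono => mono.
    have /= /ltW -> := mono _ _ I1 It t1t.
    by have /= /ltW -> := mono _ _ It I0 tt0; rewrite orbT.
  have /= /ltW -> := mono _ _ It I1 t1t.
  by have /= /ltW -> := mono _ _ I0 It tt0; rewrite orbT.
move: sI; rewrite in_itv /= => /andP[t1s st0].
have s0 : 0 < s by rewrite (lt_le_trans t1_gt0).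
have sd : s < d by rewrite (le_lt_trans st0).
have [u uI eu] := cE t ltac:(by move: It; rewrite in_itv).
have [w wI ew] := c'E s ltac:(by rewrite s0 sd).
have wu : w = u by move: gcs; rewrite /= -eu -ew !gE.
(* Both parameters measure the distance from [v] to the common point [c t = c' s]. *)
have st : s = t; last by rewrite -eu -st -ew wu.
rewrite -(isometric_dist0 Ic' _ _ (ltW s0)) /= ?in_itv /= ?lexx //; last first.
  by rewrite ltW //= (lt_le_trans sd).
rewrite c'0 -ew wu eu -c0 (isometric_dist0 Ic) //= ?in_itv /= ?lexx ?ltW //=.
by rewrite (lt_le_trans _ de) // (lt_trans tt0).
Qed.

End Rays.

(** * Tangent vectors and slopes *)

Section SegmentCover.
Context {R : realType} {T : metricType R}.
Implicit Types (c : R -> T) (v : T).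

Lemma germ_eq c c' : c 0 = c' 0 -> (\forall t \near 0^'+, c t = c' t) ->
  germ c = germ c'.
Proof.
move=> cc0 cc'; apply/seteqP; split=> k [k0 kc]; split; rewrite ?k0 //.
  by apply: filterS2 kc cc' => t -> ->.
by apply: filterS2 kc cc' => t -> ->.
Qed.

Lemma germ_refl c : germ c c.
Proof. by split=> //; apply: nearW. Qed.

(** This is the part of [piecewise_linear] that does not depend on the function. The segments may
    overlap and need not be edges of a graph structure. *)
Definition segment_cover n (seg : 'I_n -> R -> T) (len : 'I_n -> R) : Prop :=
  (forall i, isometric_on `[0, len i] (seg i)) /\
  (forall x, exists i, (seg i @` `[0, len i]) x).

Context n (seg : 'I_n -> R -> T) (len : 'I_n -> R).
Hypothesis covT : segment_cover seg len.
Hypothesis graphT : topological_graph R T.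

Lemma closed_segment i : closed (seg i @` `[0, len i]).
Proof.
apply: compact_closed; first exact: metric_hausdorff.
apply: continuous_compact; last exact: segment_compact.
by apply: isometric_continuous; exact: covT.1.
Qed.

(** One of the finitely many closed segments is met at arbitrarily small parameters, hence contains
    [v], at [tau] say. Isometry puts each meeting at [tau + t] or [tau - t]; a sign [b] that recurs
    gives a ray along the segment, which [rays_near_eq] identifies with [c]. *)
Lemma ray_in_segment c v : rays v c -> exists i (b : bool) (tau : R),
  [/\ 0 <= tau <= len i, seg i tau = v &
  \forall t \near 0^'+, 0 <= tau + (-1) ^+ b * t <= len i /\
    c t = seg i (tau + (-1) ^+ b * t)].
Proof.
move=> rc; have dc := ray_dist rc.
have [i Hi] : exists i, ~ \forall t \near 0^'+, ~ (seg i @` `[0, len i]) (c t).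
  apply: contrapT => /forallNP H.
  have /filter_forall : forall i, \forall t \near 0^'+, ~ (seg i @` `[0, len i]) (c t).
    by move=> i; apply: contrapT; exact: H.
  move=> /filter_ex[t Ht]; have [i] := covT.2 (c t); exact: Ht.
have [tau tauI tauv] : (seg i @` `[0, len i]) v.
  apply: contrapT => vi; apply: Hi.
  have : nbhs v (~` (seg i @` `[0, len i])).
    apply: open_nbhs_nbhs; split=> //; apply: closed_openC; exact: closed_segment.
  move=> /nbhs_ballP[e /= e0 He].
  apply: filterS2 dc (nbhs_right_lt e0) => t dt te; apply: He.
  by rewrite ballEmdist /= dt.
move: tauI; rewrite /= in_itv /= => tauI.
pose P (b : bool) (t : R) := 0 <= tau + (-1) ^+ b * t <= len i /\
    c t = seg i (tau + (-1) ^+ b * t).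
have [b Pb] : exists b, ~ \forall t \near 0^'+, ~ P b t.
  suff : ~ \forall t \near 0^'+, ~ (P false t \/ P true t).
    by move=> /frequently_or[]; [exists false|exists true].
  move=> H; apply: Hi; apply: filterS3 H dc (nbhs_right_gt 0) => t H dt t0 [u /=].
  rewrite in_itv /= => uI cu; apply: H.
  have : `|tau - u| = t by rewrite -(covT.1 i) /= ?in_itv //= tauv cu.
  rewrite /P expr0 expr1 mul1r mulN1r.
  have [ut|ut] := leP u tau.
    rewrite ger0_norm; last lra.
    by move=> ?; right; have -> : tau - t = u by lra.
  rewrite ltr0_norm; last lra.
  by move=> ?; left; have -> : tau + t = u by lra.
exists i, b, tau; split=> //.
(* A single meeting parameter [t1] shows that the segment extends at least that far from [tau] in
   direction [b]; the bound 1 is arbitrary. *)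
have [t1 /andP[t10 _] [t1I ct1]] := (frequently_at_right0P _).1 Pb 1 ltac:(lra).
have inI w : 0 <= w < t1 -> 0 <= tau + (-1) ^+ b * w <= len i.
  by move: t1I; case: (b); rewrite /= ?expr0 ?expr1 ?mul1r ?mulN1r; lra.
pose k t := seg i (tau + (-1) ^+ b * t).
have rk : rays v k.
  split; first by rewrite /k mulr0 addr0.
  exists t1 => // s t; rewrite /= !in_itv /= => sI tI.
  rewrite /k (covT.1 i) /= ?in_itv /= ?inI //.
  by rewrite opprD addrACA subrr add0r -mulrBr normrM normrX normrN1 expr1n mul1r.
have H : ~ \forall t \near 0^'+, ~ (c t = k t).
  by move=> H'; apply: Pb; apply: filterS H' => t ck [_].
have := rays_near_eq graphT rc rk H.
apply: filterS3 (nbhs_right_lt t10) (nbhs_right_gt 0) => t tt1 t0 ->.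
by rewrite inI // ltW.
Qed.

Lemma finite_tangent_vectors v : finite_set (tangent_vectors v).
Proof.
(* On a segment that misses [v] the default 0 only adds a spurious value to the range of [F]. *)
pose tau i := xget 0 [set tau | 0 <= tau <= len i /\ seg i tau = v].
pose F (p : 'I_n * bool) := germ (fun t => seg p.1 (tau p.1 + (-1) ^+ p.2 * t)).
apply: (@sub_finite_set _ _ (range F)); last exact: finite_image finite_finset.
move=> _ [c rc <-]; have [i [b [u [uI uv near_c]]]] := ray_in_segment rc.
have tu : tau i = u.
  apply: xget_unique => // w [wI wv]; apply: (isometric_inj (covT.1 i)).
  - by rewrite /= in_itv.
  - by rewrite /= in_itv.
  - by rewrite wv.
exists (i, b) => //; apply: germ_eq; rewrite /= tu.
  by rewrite mulr0 addr0 uv; case: rc.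
by apply: filterS near_c => t [].
Qed.

Lemma linear_on_ray (phi : T -> R) (m : 'I_n -> int) c v :
  (forall i (t : R), 0 <= t <= len i -> phi (seg i t) = phi (seg i 0) + (m i)%:~R * t) ->
  rays v c ->
  exists k : int, \forall t \near 0^'+, phi (c t) = phi (c 0) + k%:~R * t.
Proof.
move=> lin rc; have [i [b [u [uI uv near_c]]]] := ray_in_segment rc.
exists ((-1) ^+ b * m i); apply: filterS near_c => t [tI ->].
rewrite (lin i) // (_ : c 0 = seg i u); last by rewrite uv; case: rc.
rewrite (lin i u) // mulrDr addrA rmorphM rmorphXn rmorphN1 /=; congr (_ + _).
by rewrite mulrA (mulrC (m i)%:~R).
Qed.

End SegmentCover.

Section Slope.
Context {R : realType} {T : metricType R}.
Implicit Types (c : R -> T) (v : T) (phi : T -> R).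

(** The choice made by [slope] is unambiguous: two candidates agree at one small positive parameter,
    which can be cancelled. *)
Lemma slope_germ c phi (m : int) :
  (\forall t \near 0^'+, phi (c t) = phi (c 0) + m%:~R * t) -> slope (germ c) phi = m.
Proof.
move=> H; rewrite /slope; apply: xget_unique.
  by exists c => //; exact: germ_refl.
move=> k [c' [c'0 c'c] Hk].
have [t [t0 ct c't ck]] : exists t : R, [/\ 0 < t, c' t = c t,
   phi (c' t) = phi (c' 0) + k%:~R * t & phi (c t) = phi (c 0) + m%:~R * t].
  suff /filter_ex[t [? ? ? ?]] : \forall t \near (0:R)^'+, [/\ 0 < t, c' t = c t,
     phi (c' t) = phi (c' 0) + k%:~R * t & phi (c t) = phi (c 0) + m%:~R * t].
    by exists t.
  near=> t; split; near: t => //; exact: nbhs_right_gt.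
have : k%:~R * t = m%:~R * t :> R.
  by apply: (addrI (phi (c 0))); rewrite -ck -c'0 -c't ct.
by move=> /(mulIf (lt0r_neq0 t0)) /eqP; rewrite eqr_int => /eqP.
Unshelve. all: end_near. Qed.

Lemma slope_PL c v phi : topological_graph R T -> piecewise_linear phi -> rays v c ->
  \forall t \near 0^'+, phi (c t) = phi (c 0) + (slope (germ c) phi)%:~R * t.
Proof.
move=> gT [_ [n [seg [len [m [iso cov lin]]]]]] rc.
have [|k Hk] := @linear_on_ray _ _ n seg len _ gT phi m c v lin rc.
  by split.
by rewrite (slope_germ Hk).
Qed.

Lemma PL_segment_cover phi : piecewise_linear phi ->
  exists n (seg : 'I_n -> R -> T) len, segment_cover seg len.
Proof. by move=> [_ [n [seg [len [m [iso cov _]]]]]]; exists n, seg, len. Qed.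

(* If infinitely many slopes occurred, r+2 functions with distinct slopes along
   [zeta] would be tropically dependent; but near the base point two of the
   resulting affine functions coincide at only one parameter. *)
Lemma finite_slopes (Sigma : set (T -> R)) r v zeta : topological_graph R T ->
  Sigma `<=` piecewise_linear ->
  (forall phi : 'I_r.+2 -> T -> R, injective phi ->
       (forall i, Sigma (phi i)) -> tropically_dependent phi) ->
  tangent_vectors v zeta -> finite_set (slopes Sigma zeta).
Proof.
move=> gT SPL dep [c rc <-]; apply: contrapT => /(infinite_set_fset r.+2)[F FS Fr].
pose s := finmap.enum_fset F.
have : forall i : 'I_r.+2, exists phi, Sigma phi /\ slope (germ c) phi = nth 0 s i.
  move=> i; have : slopes Sigma (germ c) (nth 0 s i).
    by apply: FS; apply: mem_nth; exact: leq_trans Fr.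
  by case=> phi ? ?; exists phi.
move=> /choice[phi Hphi].
have inj_slope i j : slope (germ c) (phi i) = slope (germ c) (phi j) -> i = j.
  rewrite (Hphi i).2 (Hphi j).2 => /eqP.
  rewrite nth_uniq ?finmap.fset_uniq //; last 2 first.
  - exact: leq_trans Fr.
  - exact: leq_trans Fr.
  by move=> /eqP/val_inj.
have [|i|a Ha] := dep phi; first by move=> i j ij; apply: inj_slope; rewrite ij.
  exact: (Hphi i).1.
have lin : \forall t \near 0^'+, forall i,
    phi i (c t) = phi i (c 0) + (slope (germ c) (phi i))%:~R * t.
  by apply: filter_forall => i; apply: slope_PL rc => //; apply: SPL; exact: (Hphi i).1.
pose b i := phi i (c 0) + a i; pose m i : R := (slope (germ c) (phi i))%:~R.
(* These are the parameters where two of the affine functions cross. Pairs with equal slopes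
   contribute the harmless value 0 of a division by zero. *)
have := @near_right_avoid_finite R
  [set (b p.2 - b p.1) / (m p.1 - m p.2) | p in [set: 'I_r.+2 * 'I_r.+2]].
move=> /(_ (finite_image _ finite_finset)) avoid.
suff /filter_ex[] : \forall t \near (0 : R)^'+, False by [].
apply: filterS2 lin avoid => t lin_t.
have [i [j [ij mini minj]]] := Ha (c t); apply; exists (i, j) => //=.
have mij : m i - m j != 0.
  rewrite subr_eq0 eqr_int; apply/eqP => /inj_slope/eqP; exact/negP.
have e : phi i (c t) + a i = phi j (c t) + a j.
  by apply: le_anti; rewrite mini minj.
apply: (mulIf mij); rewrite divfK //.
by move: e; rewrite !lin_t /b /m; lra.
Qed.

End Slope.

(** * Induced length metric *)

Section Lengths.
Context {R : realType} {T : metricType R}.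
Implicit Types (c : R -> T) (A : set T).

Lemma chord_sum_cons c (a x : R) s :
  chord_sum c a (x :: s) = mdist (c a) (c x) + chord_sum c x s.
Proof.
rewrite /chord_sum /= big_ord_recl /=; congr (_ + _); apply: eq_bigr => i _.
rewrite /= (@set_nth_default _ (x :: s) x a) /=; last by rewrite ltnS (ltnW (ltn_ord i)).
by rewrite add0n (@set_nth_default _ s x a).
Qed.

Lemma mdist_le_intrinsic_dist A x y : ((mdist x y)%:E <= intrinsic_dist A x y)%E.
Proof.
apply: le_ereal_inf_tmp => _ [c [_ <- <- _] <-].
(* The trivial subdivision already has the distance between the endpoints as its chord sum. *)
apply: ereal_sup_ubound; exists [:: 1]; last by rewrite chord_sum_cons /chord_sum big_ord0 addr0.
by rewrite /= /itv_partition /= ltr01.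
Qed.

(** Reparametrized over the unit interval, [c] is itself a competitor, and all of its chord sums
    telescope to [b - a]. *)
Lemma intrinsic_dist_isometric A c (a b : R) : a <= b -> isometric_on `[a, b] c ->
  c @` `[a, b] `<=` A -> (intrinsic_dist A (c a) (c b) <= (b - a)%:E)%E.
Proof.
move=> ab Ic cA; pose k t := c (a + (b - a) * t).
have kI t : 0 <= t <= 1 -> a <= a + (b - a) * t <= b.
  move=> /andP[t0 t1]; have h1 := mulr_ge0 (_ : 0 <= b - a) t0.
  have h2 := mulr_ge0 (_ : 0 <= b - a) (_ : 0 <= 1 - t).
  by move: h1 h2; rewrite !subr_ge0 => /(_ ab) h1 /(_ ab t1); lra.
have dk s t : 0 <= s -> s <= t -> t <= 1 -> mdist (k s) (k t) = (b - a) * (t - s).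
  move=> s0 st t1; rewrite /k Ic /= ?in_itv /= ?kI //; last 2 first.
  - by rewrite s0 (le_trans st t1).
  - by rewrite t1 (le_trans s0 st).
  rewrite distrC opprD addrACA subrr add0r -mulrBr ger0_norm //.
  by rewrite mulr_ge0 // subr_ge0.
apply: ge_ereal_inf; exists (curve_length k); last first.
  apply: ge_ereal_sup => _ [s /= [ps /eqP ls] <-]; rewrite lee_fin.
  suff H x : 0 <= x -> path <%R x s -> last x s <= 1 ->
      chord_sum k x s = (b - a) * (last x s - x).
    by rewrite H ?ls // subr0 mulr1.
  elim: s x {ps ls} => [|y s IH] x x0 /=.
    by rewrite /chord_sum big_ord0 subrr mulr0.
  move=> /andP[xy ys] l1.
  have yl : y <= last y s by apply: (@itv_partition_le _ _ _ _ s); split.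
  rewrite chord_sum_cons IH ?(ltW (le_lt_trans x0 xy)) //.
  rewrite dk ?(ltW xy) ?(le_trans yl) //.
  by rewrite -mulrDr; congr (_ * _); lra.
have kab : [/\ k 0 = c a & k 1 = c b].
  by rewrite /k mulr0 addr0 mulr1 addrC subrK.
case: kab => k0 k1; exists k => //; split=> //; last first.
  move=> _ [t /= tI <-]; apply: cA; exists (a + (b - a) * t) => //.
  by rewrite /= in_itv /= kI //; move: tI; rewrite in_itv.
apply: (@lipschitz_within_continuous _ _ _ _ (b - a)) => s t.
rewrite /= !in_itv /= => /andP[s0 s1] /andP[t0 t1].
have [st|ts] := leP s t.
  by rewrite dk // distrC ger0_norm // subr_ge0.
by rewrite metric_sym dk ?(ltW ts) // gtr0_norm // subr_gt0.
Qed.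

End Lengths.

(** * The embedding of a subgraph *)

Section Subgraph.
Context {R : realType} {S T : metricType R} (iota : S -> T).
Hypothesis iota_dist : forall x y : S,
  (mdist x y)%:E = intrinsic_dist (range iota) (iota x) (iota y).

Lemma subgraph_dist_le x y : mdist (iota x) (iota y) <= mdist x y.
Proof. by rewrite -lee_fin iota_dist mdist_le_intrinsic_dist. Qed.

Lemma subgraph_dist_isometric c (a b : R) x y : a <= b -> isometric_on `[a, b] c ->
  c @` `[a, b] `<=` range iota -> iota x = c a -> iota y = c b -> mdist x y <= b - a.
Proof.
move=> ab Ic cA xa yb; rewrite -lee_fin iota_dist xa yb.
exact: intrinsic_dist_isometric.
Qed.

Lemma subgraph_inj : injective iota.
Proof.
move=> x y xy; apply: mdist_positivity; apply: le_anti; rewrite mdist_ge0 andbT.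
(* A constant curve on the degenerate interval from 0 to 0 joins the two equal images and has length
   zero. *)
rewrite -(subrr (0 : R)); apply: (@subgraph_dist_isometric (fun=> iota x)) => //.
- move=> s t /=; rewrite !in_itv /= => s0 t0; rewrite mdistxx.
  by rewrite (_ : s - t = 0) ?normr0 //; lra.
- by move=> _ [t _ <-]; exists x.
Qed.

Lemma subgraph_continuous : continuous iota.
Proof.
move=> x; apply/metricType_numDomainType.cvgrPdist_lt => e e0.
apply/nbhs_ballP; exists e => // y; rewrite ballEmdist /=.
exact/le_lt_trans/subgraph_dist_le.
Qed.

Lemma subgraph_closed : compact [set: S] -> closed (range iota).
Proof.
move=> cS; apply: compact_closed; first exact: metric_hausdorff.
by apply: continuous_compact cS; apply: continuous_subspaceT; exact: subgraph_continuous.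
Qed.

Lemma subgraph_connected : connected [set: S] -> connected (range iota).
Proof.
move=> cS; apply: connected_continuous_connected cS _.
by apply: continuous_subspaceT; exact: subgraph_continuous.
Qed.

(** Distances in [S] are at least the ambient ones. Conversely, the arc of [c] between two
    parameters lies in the range and bounds the induced distance by their difference. *)
Lemma subgraph_lift (x0 : S) c (I : set R) : is_interval I -> isometric_on I c ->
  c @` I `<=` range iota ->
  exists2 c', isometric_on I c' & forall t, I t -> iota (c' t) = c t.
Proof.
move=> itvI Ic cA; pose c' t := xget x0 [set x | iota x = c t].
have c'E t : I t -> iota (c' t) = c t.
  move=> It; have : exists x, iota x = c t by case: (cA (c t)) => [|x _ <-]; [exists t|exists x].
  exact: xgetPex.
exists c' => // s t; wlog st : s t / s <= t => [H|] Is It.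
  have [/H->//|/ltW ts] := leP s t.
  by rewrite metric_sym H // distrC.
apply: le_anti; rewrite ler0_norm ?subr_le0 // opprB; apply/andP; split; last first.
  apply: le_trans (subgraph_dist_le _ _); rewrite !c'E // Ic //.
  by rewrite ler0_norm ?subr_le0 // opprB.
have sI : `[s, t] `<=` I.
  by move=> u /=; rewrite in_itv /= => uI; exact: itvI uI.
apply: (@subgraph_dist_isometric c) => //; rewrite ?c'E //.
  exact: sub_isometric_on Ic.
by apply: subset_trans cA; exact: image_subset.
Qed.

End Subgraph.

(** * Segments of a subgraph *)

Lemma finite_max_below {R : realType} (B : set R) (u : R) : finite_set B ->
  (exists2 p, B p & p <= u) ->
  exists q, [/\ B q, q <= u & forall p, B p -> p <= u -> p <= q].
Proof.
move=> /finite_seqP[s ->] [p /= ps pu].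
have : (forall q, q \in s -> u < q) \/
    (exists q, [/\ q \in s, q <= u & forall p, p \in s -> p <= u -> p <= q]).
  elim: s {ps} => [|x s [IH|[q [qs qu IH]]]]; first by left.
    have [xu|ux] := leP x u; last by left=> q; rewrite inE => /orP[/eqP ->//|/IH].
    right; exists x; split; rewrite ?mem_head // => y; rewrite inE.
    by move=> /orP[/eqP -> //|/IH]; rewrite ltNge => /negP.
  right; have [xu|ux] := leP x u; last first.
    exists q; split; rewrite ?inE ?qs ?orbT // => y; rewrite inE.
    by move=> /orP[/eqP ->|/IH //]; rewrite leNgt ux.
  have [xq|qx] := leP x q.
    exists q; split; rewrite ?inE ?qs ?orbT // => y; rewrite inE.
    by move=> /orP[/eqP ->|/IH //].
  exists x; split; rewrite ?mem_head // => y; rewrite inE.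
  by move=> /orP[/eqP -> //|ys yu]; apply: le_trans (ltW qx); exact: IH.
move=> [H|[q [qs qu H]]]; last by exists q.
by have := H p ps; rewrite ltNge pu.
Qed.

Lemma finite_min_above {R : realType} (B : set R) (u : R) : finite_set B ->
  (exists2 p, B p & u <= p) ->
  exists q, [/\ B q, u <= q & forall p, B p -> u <= p -> q <= p].
Proof.
move=> finB [p Bp up].
have [||_ [[q Bq <-] qu H]] := @finite_max_below R (-%R @` B) (- u).
- exact: finite_image.
- by exists (- p); [exists p|rewrite lerN2].
exists q; split=> //; first by rewrite -lerN2.
by move=> s Bs us; rewrite -lerN2; apply: H; [exists s|rewrite lerN2].
Qed.

Section LiftedCover.
Context {R : realType} {S T : metricType R} (iota : S -> T).
Hypothesis iota_dist : forall x y : S,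
  (mdist x y)%:E = intrinsic_dist (range iota) (iota x) (iota y).
Hypothesis closed_range : closed (range iota).
Hypothesis finite_frontier : finite_set (range iota `\` (range iota)°).

Local Notation A := (range iota).

Lemma isometric_adherent (I : set R) (c : R -> T) p : isometric_on I c -> I p ->
  (forall e, 0 < e -> exists2 t, I t /\ A (c t) & `|p - t| < e) -> A (c p).
Proof.
move=> Ic Ip H; apply: contrapT => Ap.
have /nbhs_ballP[e /= e0 He] : nbhs (c p) (~` A).
  by apply: open_nbhs_nbhs; split=> //; exact: closed_openC.
have [t [It At] pt] := H e e0; apply: (He (c t)) At.
by rewrite ballEmdist /= Ic.
Qed.

(** The open arc is connected, avoids the frontier and meets [A], so it lies in [A]; the two ends
    follow because [A] is closed. *)
Lemma segment_interior_in (I : set R) (c : R -> T) (p q u : R) :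
  isometric_on I c -> `[p, q] `<=` I -> p < u < q -> A (c u) ->
  (forall t, p < t < q -> ~ (A `\` A°) (c t)) -> forall t, p <= t <= q -> A (c t).
Proof.
move=> Ic pqI puq Au avoid.
have Ioc : isometric_on `]p, q[ c.
  apply: sub_isometric_on Ic => t tI; apply: pqI; move: tI.
  by rewrite /= !in_itv /= => /andP[/ltW -> /ltW ->].
have Aoc t : p < t < q -> A (c t).
  move=> tI; have cC : connected (c @` `]p, q[).
    apply: connected_continuous_connected; last exact: isometric_continuous.
    by apply/connected_intervalP; exact: interval_is_interval.
  case: (connected_avoid_boundary cC closed_range) => [|H|H].
  - apply/seteqP; split=> x // [[s /= sI <-]]; apply: avoid.
    by move: sI; rewrite in_itv.
  - by apply: H; exists t => //=; rewrite in_itv.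
  - by case: (H (c u)) => //; exists u => //=; rewrite in_itv.
have pI : I p by apply: pqI; rewrite /= in_itv /= lexx; lra.
have qI : I q by apply: pqI; rewrite /= in_itv /= lexx; lra.
have oI t : p < t < q -> I t.
  by move=> /andP[pt tq]; apply: pqI; rewrite /= in_itv /= !ltW.
move=> t /andP[pt tq].
have [tp|tp] := eqVneq t p.
  subst t; apply: (isometric_adherent Ic) => // e e0.
  pose s := p + Num.min e (q - p) / 2.
  have m1 : Num.min e (q - p) <= e by rewrite ge_min lexx.
  have m2 : Num.min e (q - p) <= q - p by rewrite ge_min lexx orbT.
  have m0 : 0 < Num.min e (q - p) by rewrite lt_min e0; lra.
  have sI : p < s < q by rewrite /s; lra.
  exists s; first by split; [exact: oI|exact: Aoc].
  by rewrite ltr_distl /s; lra.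
have [tq'|tq'] := eqVneq t q.
  subst t; apply: (isometric_adherent Ic) => // e e0.
  pose s := q - Num.min e (q - p) / 2.
  have m1 : Num.min e (q - p) <= e by rewrite ge_min lexx.
  have m2 : Num.min e (q - p) <= q - p by rewrite ge_min lexx orbT.
  have m0 : 0 < Num.min e (q - p) by rewrite lt_min e0; lra.
  have sI : p < s < q by rewrite /s; lra.
  exists s; first by split; [exact: oI|exact: Aoc].
  by rewrite ltr_distl /s; lra.
by apply: Aoc; rewrite lt_neqAle eq_sym tp pt lt_neqAle tq' tq.
Qed.

Context n (seg : 'I_n -> R -> T) (len : 'I_n -> R).
Hypothesis covT : segment_cover seg len.

(** Between consecutive breakpoints a segment can neither enter nor leave [A]. *)
Definition breakpoints i : set R :=
  [set u | 0 <= u <= len i /\ (u = 0 \/ u = len i \/ (A `\` A°) (seg i u))].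

Lemma finite_breakpoints i : finite_set (breakpoints i).
Proof.
apply: (@sub_finite_set _ _
  ([set 0; len i] `|` mdist (seg i 0) @` (A `\` A°))).
  move=> u [uI [->|[->|Bu]]]; [by left; left|by left; right|right].
  exists (seg i u) => //; apply: (isometric_dist0 (covT.1 i)).
  - by rewrite /= in_itv /= lexx; move: uI; lra.
  - by rewrite /= in_itv.
  - by case/andP: uI.
by rewrite finite_setU; split; [exact: finite_set2|exact: finite_image].
Qed.

(** The two breakpoints need not be consecutive, since only finiteness and covering matter. They may
    coincide, which accounts for points where a segment merely touches [A]. *)
Definition good_piece (p : 'I_n * R * R) : Prop :=
  [/\ breakpoints p.1.1 p.1.2, breakpoints p.1.1 p.2, p.1.2 <= p.2 &
      seg p.1.1 @` `[p.1.2, p.2] `<=` A].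

Lemma finite_good_piece : finite_set good_piece.
Proof.
apply: (@sub_finite_set _ _ (\bigcup_(i in [set: 'I_n])
   [set (i, p, q) | p in breakpoints i & q in breakpoints i])).
  by move=> [[i p] q] [/= Bp Bq _ _]; exists i => //; exists p => //; exists q.
apply: bigcup_finite => [|i _]; first exact: finite_finset.
by apply: finite_image2; exact: finite_breakpoints.
Qed.

Lemma good_piece_cover (x : S) : exists2 p, good_piece p &
  exists2 t, p.1.2 <= t <= p.2 & seg p.1.1 t = iota x.
Proof.
have [i [u /= +]] := covT.2 (iota x); rewrite in_itv /= => uI ux.
have lenI : 0 <= len i by move: uI; lra.
have [b|nb] := pselect (breakpoints i u).
  exists (i, u, u) => /=; last by exists u => //; rewrite lexx.
  split=> //= _ [t /= tI <-]; exists x => //; rewrite -ux; congr (seg i _).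
  by move: tI; rewrite in_itv /=; lra.
have [|p [Bp pu Hp]] := @finite_max_below _ _ u (finite_breakpoints i).
  exists 0; last by case/andP: uI.
  by split; [rewrite lexx|left].
have [|q [Bq uq Hq]] := @finite_min_above _ _ u (finite_breakpoints i).
  exists (len i); last by case/andP: uI.
  by split; [rewrite lexx lenI|right; left].
have pu' : p < u.
  by rewrite lt_neqAle pu andbT; apply/eqP => e; apply: nb; rewrite -e.
have uq' : u < q.
  by rewrite lt_neqAle uq andbT; apply/eqP => e; apply: nb; rewrite e.
have [pI _] := Bp; have [qI _] := Bq.
exists (i, p, q) => /=; last by exists u => //; rewrite pu uq.
split=> //=; first exact: le_trans uq.
move=> _ [t /= tI <-]; apply: (@segment_interior_in _ _ p q u (covT.1 i)).
- by move=> s; rewrite /= !in_itv /=; lra.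
- by rewrite pu' uq'.
- by exists x.
- move=> s /andP[ps sq] Bs; have Bps : breakpoints i s by split; [lra|right; right].
  have [su|us] := leP s u.
    by have := Hp s Bps su; rewrite leNgt ps.
  by have := Hq s Bps (ltW us); rewrite leNgt sq.
- by move: tI; rewrite in_itv.
Qed.

(** Each good piece lifts to an isometric segment of [S]. The data [idx] and [off] locate it in its
    ambient segment, so that linearity and isometry can be carried across. *)
Lemma lifted_segment_cover (x0 : S) :
  exists m (seg' : 'I_m -> R -> S) (len' : 'I_m -> R) (idx : 'I_m -> 'I_n)
    (off : 'I_m -> R), segment_cover seg' len' /\
    forall k t, 0 <= t <= len' k -> 0 <= off k + t <= len (idx k) /\
      iota (seg' k t) = seg (idx k) (off k + t).
Proof.
have [s sE] := (finite_seqP _).1 finite_good_piece.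
have good (k : 'I_(size s)) : good_piece (tnth (in_tuple s) k).
  by rewrite sE /= mem_tnth.
have : forall k : 'I_(size s), exists c' : R -> S,
    let p := tnth (in_tuple s) k in isometric_on `[0, p.2 - p.1.2] c' /\
    forall t, 0 <= t <= p.2 - p.1.2 -> iota (c' t) = seg p.1.1 (p.1.2 + t).
  move=> k; have [/= [+ _] [+ _] pq At] := good k.
  move: At pq; case: (tnth (in_tuple s) k) => [[i p] q] /= At pq pI qI.
  have inI t : 0 <= t <= q - p -> 0 <= p + t <= len i by lra.
  have iso : isometric_on `[0, q - p] (fun t => seg i (p + t)).
    move=> u v /=; rewrite !in_itv /= => uI vI.
    by rewrite (covT.1 i) /= ?in_itv ?inI //= opprD addrACA subrr add0r.
  have [||c' Ic' c'E] := subgraph_lift iota_dist x0 _ iso.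
  - exact: interval_is_interval.
  - move=> _ [t /= tI <-]; apply: At; exists (p + t) => //=.
    by move: tI; rewrite !in_itv /=; lra.
  - by exists c'; split=> // t tI; apply: c'E; rewrite /= in_itv.
move=> /choice[seg' Hseg'].
exists (size s), seg', (fun k => (tnth (in_tuple s) k).2 - (tnth (in_tuple s) k).1.2),
  (fun k => (tnth (in_tuple s) k).1.1), (fun k => (tnth (in_tuple s) k).1.2).
split; first split.
- by move=> k; exact: (Hseg' k).1.
- move=> x; have [p gp [t tI pt]] := good_piece_cover x.
  have ps : p \in s by move: gp; rewrite sE.
  have /(tnthP (in_tuple s))[k pk] : p \in in_tuple s by [].
  exists k; exists (t - p.1.2); first by rewrite /= in_itv /= -pk; lra.
  apply: (subgraph_inj iota_dist); rewrite (Hseg' k).2 -pk; last lra.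
  by rewrite addrC subrK.
- move=> k t tI; split; last exact: (Hseg' k).2.
  by have [/= [+ _] [+ _] _ _] := good k; move: tI; case: (tnth (in_tuple s) k) => [[i p] q] /=; lra.
Qed.

End LiftedCover.

(** * Restriction of functions *)

Lemma topological_graph_finite_boundary {R : realType} {T : metricType R} (A : set T) :
  topological_graph R T -> connected A -> closed A -> finite_set (A `\` A°).
Proof.
move=> [V [n [edge [finV Hedge edge_notV edge_inj edge_cover]]]] cA clA.
by apply: (finite_boundary (@metric_hausdorff R T) finV _ _ edge_notV edge_inj) => // e;
  case: (Hedge e).
Qed.

Section Restriction.
Context {R : realType} {S T : metricType R} (iota : S -> T).
Hypothesis graphT : topological_graph R T.
Hypothesis subS : metric_subgraph iota.

Local Notation A := (range iota).

Let iota_dist := subS.2.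

Lemma subgraph_topological_graph : topological_graph R S.
Proof. by have [_ _ _ _ ?] := subS.1. Qed.

Lemma subgraph_point : exists x : S, True.
Proof. by have [[x _] _ _ _ _] := subS.1; exists x. Qed.

Lemma range_closed : closed A.
Proof. by apply: subgraph_closed iota_dist _; have [] := subS.1. Qed.

Lemma range_finite_boundary : finite_set (A `\` A°).
Proof.
apply: topological_graph_finite_boundary graphT _ range_closed.
by apply: subgraph_connected iota_dist _; have [] := subS.1.
Qed.

Lemma piecewise_linear_restrict phi : piecewise_linear phi -> piecewise_linear (phi \o iota).
Proof.
move=> [cphi [n [seg [len [m [iso cov lin]]]]]]; split.
  move=> x; apply: continuous_comp; [exact: subgraph_continuous|exact: cphi].
have [x0 _] := subgraph_point.
have [k [seg' [len' [idx [off [[iso' cov'] H]]]]]] :=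
  lifted_segment_cover iota_dist range_closed range_finite_boundary (conj iso cov) x0.
exists k, seg', len', (fun i => m (idx i)); split=> // i t tI.
have zI : 0 <= (0 : R) <= len' i by lra.
have [tJ /= ->] := H i t tI; have [zJ ->] := H i 0 zI.
by rewrite (lin _ _ tJ) (lin _ _ zJ) addr0 mulrDr addrA.
Qed.

Context n (seg : 'I_n -> R -> T) (len : 'I_n -> R).
Hypothesis covT : segment_cover seg len.

(* A ray of the subgraph is locally a lift of a piece of a segment of the
   ambient graph, hence remains isometric there. *)
Lemma ray_push w c : rays w c -> rays (iota w) (iota \o c).
Proof.
move=> rc; have [x0 _] := subgraph_point.
have [k [seg' [len' [idx [off [cov' H]]]]]] :=
  lifted_segment_cover iota_dist range_closed range_finite_boundary covT x0.
have [i [b [tau [tauI tauw near_c]]]] := ray_in_segment cov' subgraph_topological_graph rc.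
split; first by case: rc => /= ->.
have /near_at_right0P[d d0 Hd] := near_c; exists d => //.
have E t : 0 <= t < d -> 0 <= off i + (tau + (-1) ^+ b * t) <= len (idx i) /\
    iota (c t) = seg (idx i) (off i + (tau + (-1) ^+ b * t)).
  move=> /andP[t0 td]; have [t00|t00] := eqVneq t 0.
    have [tauJ e] := H i tau tauI; rewrite t00 mulr0 addr0; split=> //.
    by rewrite -e tauw; case: rc => ->.
  have [tI ->] : 0 <= tau + (-1) ^+ b * t <= len' i /\ c t = seg' i (tau + (-1) ^+ b * t).
    by apply: Hd; rewrite td andbT lt_neqAle eq_sym t00.
  exact: H.
move=> s t /=; rewrite !in_itv /= => sI tI.
have [[sJ ->] [tJ ->]] := (E s sI, E t tI).
rewrite (covT.1 (idx i)) /= ?in_itv //.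
rewrite opprD addrACA subrr add0r opprD addrACA subrr add0r -mulrBr.
by rewrite normrM normrX normrN1 expr1n mul1r.
Qed.

(** A short punctured piece of the ray is connected and avoids the finite frontier, so it lies
    outside [A] or inside it; in the second case it lifts. *)
Lemma ray_dichotomy w c : rays (iota w) c ->
  (\forall t \near 0^'+, ~ A (c t)) \/
  (exists2 c', rays w c' & \forall t \near 0^'+, c t = iota (c' t)).
Proof.
move=> rc; have [c0 [eps eps0 Ic]] := rc.
have /near_at_right0P[d0 d00 Hd] := ray_avoid_finite rc range_finite_boundary.
pose d := Num.min d0 eps.
have d_gt0 : 0 < d by rewrite lt_min d00.
have [dd de] : d <= d0 /\ d <= eps by rewrite !ge_min !lexx orbT.
have [|inA|outA] := connected_avoid_boundary (ray_connected Ic de) range_closed.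
- apply/seteqP; split=> x // [[t /= + <-]]; rewrite in_itv /= => /andP[t0 td].
  by apply: Hd; rewrite t0 (lt_le_trans td).
- right; have [|||c' Ic' c'E] := subgraph_lift iota_dist w _ (_ : isometric_on `[0, d[ c).
  + exact: interval_is_interval.
  + apply: sub_isometric_on Ic => t /=.
    by rewrite !in_itv /= => /andP[-> /lt_le_trans->].
  + move=> _ [t /= + <-]; rewrite in_itv /= => /andP[t0 td].
    have [t00|t00] := eqVneq t 0; first by rewrite t00 c0; exists w.
    by apply: inA; exists t => //=; rewrite in_itv /= td andbT lt_neqAle eq_sym t00.
  + exists c'.
      split; last by exists d.
      apply: (subgraph_inj iota_dist); rewrite c'E ?c0 //= in_itv /= lexx //.
    apply/near_at_right0P; exists d => // t /andP[t0 td].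
    by rewrite c'E //= in_itv /= ltW.
- left; apply/near_at_right0P; exists d => // t tI.
  by apply: outA; exists t => //=; rewrite in_itv.
Qed.

(** The plain image of [zeta] would be too small to be a germ, as an ambient representative may
    leave the range at larger parameters. *)
Definition push_germ (zeta : set (R -> S)) : set (R -> T) :=
  \bigcup_(c in zeta) germ (iota \o c).

Lemma push_germE c : push_germ (germ c) = germ (iota \o c).
Proof.
apply/seteqP; split=> [k [c' [c'0 c'c]]|k ck]; last by exists c => //; exact: germ_refl.
rewrite (@germ_eq _ _ _ (iota \o c)) //= ?c'0 //.
by apply: filterS c'c => t ->.
Qed.

Lemma push_germ_inj w zeta zeta' : tangent_vectors w zeta -> tangent_vectors w zeta' ->
  push_germ zeta = push_germ zeta' -> zeta = zeta'.
Proof.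
move=> [c [c0 _] <-] [c' [c'0 _] <-]; rewrite !push_germE => e.
have [_ H] : germ (iota \o c') (iota \o c) by rewrite -e; exact: germ_refl.
apply: germ_eq; first by rewrite c0 c'0.
by apply: filterS H => t /(subgraph_inj iota_dist).
Qed.

Lemma push_germ_tangent w zeta : tangent_vectors w zeta ->
  tangent_vectors (iota w) (push_germ zeta).
Proof.
by move=> [c rc <-]; rewrite push_germE; exists (iota \o c) => //; exact: ray_push.
Qed.

Lemma tangent_vectors_split w : tangent_vectors (iota w) =
  push_germ @` tangent_vectors w `|` outward_tangent_vectors A (iota w).
Proof.
apply/seteqP; split=> [_ [c rc <-]|_ [[zeta zw <-]|[]//]]; last exact: push_germ_tangent.
have [outA|[c' rc' cc']] := ray_dichotomy rc.
  right; split; first by exists c.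
  by exists c => //; exact: germ_refl.
left; exists (germ c'); first by exists c'.
rewrite push_germE; apply: germ_eq; last by apply: filterS cc' => t ->.
by rewrite /=; case: rc => ->; case: rc' => ->.
Qed.

Lemma push_germ_not_outward w :
  push_germ @` tangent_vectors w `&` outward_tangent_vectors A (iota w) `<=` set0.
Proof.
move=> _ [[_ [c _ <-] <-] [_ [k]]]; rewrite push_germE => -[_ kc] kA.
suff /filter_ex[] : \forall t \near (0 : R)^'+, False by [].
by apply: filterS2 kc kA => t -> /=; apply; exists (c t).
Qed.

Lemma slope_germE {U : metricType R} (c : R -> U) phi : slope (germ c) phi =
  xget 0 [set m : int | \forall t \near 0^'+, phi (c t) = phi (c 0) + m%:~R * t].
Proof.
rewrite /slope; congr xget; apply/seteqP; split=> m /=; last first.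
  by move=> ?; exists c => //; exact: germ_refl.
by move=> [c' [-> c'c]]; apply: filterS2 c'c => t ->.
Qed.

Lemma slope_push w zeta phi : tangent_vectors w zeta ->
  slope (push_germ zeta) phi = slope zeta (phi \o iota).
Proof. by move=> [c _ <-]; rewrite push_germE !slope_germE. Qed.

Lemma finite_subgraph_tangent_vectors (w : S) : finite_set (tangent_vectors w).
Proof.
have [x0 _] := subgraph_point.
have [k [seg' [len' [idx [off [cov' H]]]]]] :=
  lifted_segment_cover iota_dist range_closed range_finite_boundary covT x0.
exact: (finite_tangent_vectors cov' subgraph_topological_graph w).
Qed.

Lemma finite_outward_tangent_vectors w :
  finite_set (outward_tangent_vectors A (iota w)).
Proof.
apply: sub_finite_set (finite_tangent_vectors covT graphT (iota w)).
by move=> zeta [].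
Qed.

Definition outward_slope phi w : int :=
  \sum_(zeta \in outward_tangent_vectors A (iota w)) slope zeta phi.

(** Splitting the ambient directions leaves those of the subgraph, where the slopes agree, while the
    outward slopes cancel. *)
Lemma ord_restrict phi w : ord (phi \o iota) w = ord phi (iota w) + outward_slope phi w.
Proof.
rewrite /ord /outward_slope tangent_vectors_split fsbigU0 /=; last 3 first.
- exact/finite_image/finite_subgraph_tangent_vectors.
- exact: finite_outward_tangent_vectors.
- exact: push_germ_not_outward.
rewrite (fsbig_image (tangent_vectors w) push_germ); last first.
  move=> z z' /set_mem zw /set_mem z'w; exact: (push_germ_inj zw z'w).
rewrite opprD addrNK; congr (- _); apply: eq_fsbigr => zeta /set_mem zw.
by rewrite (slope_push _ zw).
Qed.

(** This confines the correction term of the restricted divisor to the finite frontier. *)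
Lemma outward_boundary w zeta : outward_tangent_vectors A (iota w) zeta ->
  (A `\` A°) (iota w).
Proof.
move=> [[c rc <-] [k [k0 kc] kA]]; split; first by exists w.
move=> /nbhs_ballP[e /= e0 He].
suff /filter_ex[] : \forall t \near (0 : R)^'+, False by [].
have ckA : \forall t \near 0^'+, ~ A (c t).
  by apply: filterS2 kc kA => t ->.
apply: filterS3 (ray_dist rc) ckA (nbhs_right_lt e0) => t dt ctA te; apply: ctA.
by apply: He; rewrite ballEmdist /= dt.
Qed.

End Restriction.

(** * Restriction of linear series *)

Lemma int_min_le (A : set int) (b m : int) : (forall m, A m -> b <= m) -> A m ->
  int_min A <= m.
Proof.
move=> Ab Am.
(* Elements are written as offsets from the lower bound [b], so that the well-ordering of [nat]
   yields a least one. *)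
have : exists n : nat, `[< A (b + n%:Z) >].
  by exists `|m - b|%N; apply/asboolP; rewrite gez0_abs ?subr_ge0 ?Ab // subrKC.
case/ex_minnP => k /asboolP Ak kmin; rewrite /int_min.
have /(xgetPex 0) [_ ->//] : exists m0, [set m | A m /\ forall m', A m' -> m <= m'] m0.
exists (b + k%:Z); split=> // m' Am'; rewrite -lerBrDl.
have bm' := Ab _ Am'; rewrite -(@gez0_abs (m' - b)) ?subr_ge0 // lez_nat.
by apply: kmin; apply/asboolP; rewrite gez0_abs ?subr_ge0 // subrKC.
Qed.

(** The default value of [int_min] takes care of the empty set. *)
Lemma int_min_sub0 (A : set int) : A `<=` [set 0] -> int_min A = 0.
Proof. by move=> A0; rewrite /int_min; case: xgetP => // m -> [/A0]. Qed.

Lemma finite_int_lower_bound (A : set int) : finite_set A ->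
  exists b, forall m, A m -> b <= m.
Proof.
move=> /finite_seqP[s ->]; elim: s => [|x s [b Hb]]; first by exists 0.
exists (Num.min x b) => m /=; rewrite inE => /orP[/eqP ->|/Hb bm].
  by rewrite ge_min lexx.
by rewrite ge_min bm orbT.
Qed.

Section RestrictedSeries.
Context {R : realType} {S T : metricType R} (iota : S -> T).
Hypothesis graphT : topological_graph R T.
Hypothesis subS : metric_subgraph iota.
Context n (seg : 'I_n -> R -> T) (len : 'I_n -> R).
Hypothesis covT : segment_cover seg len.
Context (D : T -> int) (Sigma0 : set (T -> R)).
Hypothesis finite_slopes0 : forall v zeta, tangent_vectors v zeta ->
  finite_set (slopes Sigma0 zeta).

Local Notation A := (range iota).
Local Notation D' := (restricted_divisor iota D Sigma0).

Lemma restricted_divisorE w : D' w =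
  D (iota w) - int_min [set outward_slope iota phi w | phi in Sigma0].
Proof. by []. Qed.

Lemma restricted_divisor_is_divisor : is_divisor D -> is_divisor D'.
Proof.
move=> finD; have inj := subgraph_inj subS.2.
apply: (@sub_finite_set _ _
  (iota @^-1` ([set v | D v != 0] `|` (A `\` A°)))); last first.
  apply: finite_preimage; first by move=> x y _ _; exact: inj.
  by rewrite finite_setU; split=> //; exact: range_finite_boundary.
move=> w /=; rewrite restricted_divisorE.
have [|nb] := pselect ((A `\` A°) (iota w)); first by right.
rewrite int_min_sub0 ?subr0; first by left.
move=> _ [phi _ <-]; rewrite /outward_slope /= fsbig1 // => zeta /outward_boundary.
by move=> /nb.
Qed.

(** Finitely many slopes occur along each of finitely many outward directions; summing their lower
    bounds bounds the outward slopes below, so the minimum is attained. *)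
Lemma outward_slope_min phi w : Sigma0 phi ->
  int_min [set outward_slope iota psi w | psi in Sigma0] <= outward_slope iota phi w.
Proof.
move=> phi0.
have /choice[b Hb] : forall zeta, exists b, forall psi,
    outward_tangent_vectors A (iota w) zeta -> Sigma0 psi -> b <= slope zeta psi.
  move=> zeta; have [[zw _]|no] := pselect (outward_tangent_vectors A (iota w) zeta).
    have [b Hb] := finite_int_lower_bound (finite_slopes0 zw).
    by exists b => psi _ psi0; apply: Hb; exists psi.
  by exists 0 => psi /no.
apply: (@int_min_le _ (\sum_(zeta \in outward_tangent_vectors A (iota w)) b zeta));
  last by exists phi.
have finO := finite_outward_tangent_vectors iota graphT covT w.
move=> _ [psi psi0 <-]; rewrite /outward_slope !fsbig_finite //=.
rewrite !big_seq; apply: ler_sum => zeta; rewrite in_fset_set // => /set_mem zO.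
exact: Hb.
Qed.

(** This one inequality transfers both membership in [RR] and the rank condition to the subgraph. *)
Lemma restricted_ord_ge phi w : Sigma0 phi ->
  ord phi (iota w) + D (iota w) <= ord (phi \o iota) w + D' w.
Proof.
move=> phi0; rewrite (ord_restrict graphT subS covT) restricted_divisorE.
by have := outward_slope_min w phi0; lia.
Qed.

(** Extension by zero, which turns a rank test on the subgraph into one on the ambient graph. *)
Definition push_divisor (E : S -> int) (v : T) : int :=
  if pselect (exists w, iota w = v) is left ex then E (projT1 (cid ex)) else 0.

Lemma push_divisor_iota E w : push_divisor E (iota w) = E w.
Proof.
rewrite /push_divisor; case: pselect => [ex|[]]; last by exists w.
by case: cid => x /= /(subgraph_inj subS.2) ->.
Qed.

Lemma push_divisor_out E v : ~ A v -> push_divisor E v = 0.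
Proof.
rewrite /push_divisor; case: pselect => // -[w wv] []; by exists w.
Qed.

Lemma push_divisor_is_divisor E : is_divisor E -> is_divisor (push_divisor E).
Proof.
move=> finE; apply: sub_finite_set (finite_image iota finE) => v /= Ev.
have [[w _ wv]|nA] := pselect (A v); last by rewrite push_divisor_out ?eqxx in Ev.
by exists w => //; rewrite -wv push_divisor_iota in Ev.
Qed.

Lemma degree_push_divisor E : degree (push_divisor E) = degree E.
Proof.
rewrite /degree -(fsbig_widen A setT) //; last first.
  by move=> v [_ vA]; rewrite /= push_divisor_out.
rewrite (fsbig_image setT iota); last by move=> x y _ _ /(subgraph_inj subS.2).
by apply: eq_fsbigr => w _; rewrite push_divisor_iota.
Qed.

Lemma push_divisor_ge0 E : (forall w, 0 <= E w) -> forall v, 0 <= push_divisor E v.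
Proof. by move=> E0 v; rewrite /push_divisor; case: pselect. Qed.

Lemma restricted_lift k (Sigma : set (T -> R)) (psi : 'I_k -> S -> R) :
  (forall i, restricted_series iota Sigma (psi i)) ->
  exists2 phi : 'I_k -> T -> R, (forall i, Sigma (phi i)) &
    psi = fun i => phi i \o iota.
Proof.
move=> H; have /choice[phi Hphi] : forall i, exists phi, Sigma phi /\ phi \o iota = psi i.
  by move=> i; have [phi ? ?] := H i; exists phi.
exists phi; first by move=> i; exact: (Hphi i).1.
by apply/funext => i; rewrite (Hphi i).2.
Qed.

(** As the slope sets coincide, the i-th slope is the same integer on both sides and the recursive
    condition can be pulled back. *)
Lemma slopes_restrict (Sigma : set (T -> R)) w zeta : tangent_vectors w zeta ->
  slopes (restricted_series iota Sigma) zeta = slopes Sigma (push_germ iota zeta).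
Proof.
move=> zw; apply/seteqP; split=> [_ [_ [phi phiS <-] <-]|_ [phi phiS <-]].
  by exists phi => //; rewrite (slope_push iota _ zw).
by exists (phi \o iota); [exists phi|rewrite (slope_push iota _ zw)].
Qed.

(* The divisor stays that of [Sigma0] while the series shrinks along the
   recursion on the rank, since the minimum defining it only grows on subsets. *)
Lemma restricted_linear_series r (Sigma : set (T -> R)) :
  tropical_linear_series D r Sigma -> Sigma `<=` Sigma0 ->
  tropical_linear_series D' r (restricted_series iota Sigma).
Proof.
elim/ltn_ind: r Sigma => r IH Sigma H; case: {r Sigma} H IH.
move=> r Sigma [SPL Scomb] SD Srank Sdep Srec IH S0; constructor.
- split=> [_ [phi /SPL phiPL <-]|k psi a /restricted_lift[phi phiS ->]].
    exact: piecewise_linear_restrict phiPL.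
  by exists (tropical_comb phi a); [exact: Scomb|].
- move=> _ [phi phiS <-]; split.
    exact: piecewise_linear_restrict (SPL _ phiS).
  move=> w; apply: le_trans (restricted_ord_ge w (S0 _ phiS)).
  by have [_] := SD _ phiS.
- move=> E divE E0 degE.
  have [|||phi phiS phiE] := Srank (push_divisor E).
  + exact: push_divisor_is_divisor.
  + exact: push_divisor_ge0.
  + by rewrite degree_push_divisor.
  exists (phi \o iota); first by exists phi.
  move=> w; apply: le_trans (restricted_ord_ge w (S0 _ phiS)).
  by rewrite -[E w]push_divisor_iota.
- move=> psi inj_psi /restricted_lift[phi phiS psiE].
  (* Distinct restrictions have distinct lifts, and the coefficients of a dependence on the ambient
     graph serve on the subgraph. *)
  have [|//|a Ha] := Sdep phi; first by move=> i j ij; apply: inj_psi; rewrite psiE ij.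
  by exists a => x; rewrite psiE; exact: Ha.
- move=> w zeta i m zw ir; rewrite /nth_slope (slopes_restrict _ zw) => Hm.
  have [Sigma' S'S S'] := Srec _ _ _ _ (push_germ_tangent graphT subS covT zw) ir Hm.
  exists (restricted_series iota Sigma').
    move=> _ [phi /S'S[phiS sl] <-]; split; first by exists phi.
    by rewrite -(slope_push iota _ zw).
  by apply: IH => // phi /S'S[/S0].
Qed.

End RestrictedSeries.

(** The rank condition is applied to the divisor consisting of [x] with multiplicity [r]. *)
Lemma tropical_linear_series_nonempty {R : realType} {T : metricType R} (D : T -> int) r
  (Sigma : set (T -> R)) (x : T) : tropical_linear_series D r Sigma -> Sigma !=set0.
Proof.
case=> {}r {}Sigma _ _ Srank _ _.
pose E v : int := if v == x then r%:Z else 0.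
have E0 v : v != x -> E v = 0 by rewrite /E => /negbTE ->.
have [|||phi phiS _] := Srank E; last by exists phi.
- apply: sub_finite_set (finite_set1 x) => v /= Ev.
  by apply/eqP; apply: contraNT Ev => /E0 ->.
- by move=> v; rewrite /E; case: ifP.
- rewrite /degree -(fsbig_widen [set x] setT) //; last first.
    by move=> v [_ /eqP vx]; rewrite /= E0.
  by rewrite fsbig_set1 /E eqxx.
Qed.

Lemma tropical_linear_series_finite_slopes {R : realType} {T : metricType R}
    (D : T -> int) r (Sigma : set (T -> R)) v zeta : topological_graph R T ->
  tropical_linear_series D r Sigma -> tangent_vectors v zeta ->
  finite_set (slopes Sigma zeta).
Proof.
by move=> graphT; case=> {}r {}Sigma [SPL _] _ _ Sdep _; exact: (finite_slopes graphT SPL Sdep).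
Qed.

Lemma tropical_linear_series_PL {R : realType} {T : metricType R} (D : T -> int) r
  (Sigma : set (T -> R)) : tropical_linear_series D r Sigma -> Sigma `<=` piecewise_linear.
Proof. by case=> {}r {}Sigma []. Qed.

Theorem lemma4p2 (R : realType) (Gamma : metricType R) (hGamma : metric_graph Gamma)
    (D : Gamma -> int) (hD : is_divisor D)
    (r : nat) (Sigma : set (Gamma -> R)) (hSigma : tropical_linear_series D r Sigma)
    (Gamma' : metricType R) (iota : Gamma' -> Gamma) (hGamma' : metric_subgraph iota) :
  let D' := restricted_divisor iota D Sigma in
  is_divisor D' /\ tropical_linear_series D' r (restricted_series iota Sigma).
Proof.
move=> D'; have [[x _] _ _ _ graphG] := hGamma.
split; first exact: restricted_divisor_is_divisor.
have [phi phiS] := tropical_linear_series_nonempty x hSigma.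
(* The edges of a graph structure are only continuous curves; a cover by isometric segments is read
   off from a member of [Sigma]. *)
have [n [seg [len cov]]] := PL_segment_cover (tropical_linear_series_PL hSigma phiS).
apply: (restricted_linear_series graphG hGamma' cov _ hSigma) => // v zeta.
exact: tropical_linear_series_finite_slopes hSigma.
Qed.
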